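(* Assume that the horizontal pseudo-bundle $\mathcal H\to E^{\mathrm{sph}}(G)$ is locally of finite rank $r$ and is equipped with a non-degenerate metric $\bar g$, a Clifford module $\mathcal E$, and a Clifford-compatible connection $\nabla^{\mathcal E}$. For a local $\bar g$-orthonormal frame $(e_1,\dots,e_r)$ of $\mathcal H$ put $$D=\sum_{a=1}^r c(e_a)\nabla^{\mathcal E}_{e_a},$$ where $c(e_a)$ denotes Clifford multiplication. Then the operator $D$ is independent of the choice of local orthonormal frame.
   Context: Spherical Milnor space: $E^{\mathrm{sph}}(G)$ is the set of families $(x_i,g_i)_{i\in\mathbb N}$ with $x_i\in\mathbb R$ finitely supported, $\sum_i x_i^2=1$, $g_i\in G$, modulo $(x_i,g_i)\sim(x_i,g_i')$ iff $g_i=g_i'$ whenever $x_i\ne0$; it carries the final diffeology generated by its finite local models $S_I\times G^I$ ($I\subset\mathbb N$ finite, $S_I$ the unit sphere of $\mathbb R^I$). The barycentric metric $g$ is given on local models by $\sum_{i\in I}dx_i^2+\sum_{i\in I}x_i^2\langle\cdot,\cdot\rangle_G^{(i)}$, with $\langle\cdot,\cdot\rangle_G^{(i)}$ a fixed invariant Riemannian metric on the $i$-th copy of the Lie group $G$; $\mathcal K=\ker g$, $\mathcal H=TE^{\mathrm{sph}}(G)/\mathcal K$, and $\bar g$ is the induced non-degenerate metric on $\mathcal H$. $\mathrm{Cl}(\mathcal H)$ is defined fiberwise by $v\cdot w+w\cdot v=-2\bar g(v,w)$. A Clifford module is a diffeological vector pseudo-bundle $\mathcal E\to E^{\mathrm{sph}}(G)$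 with a smooth fiberwise action $c$ of $\mathrm{Cl}(\mathcal H)$. A Clifford-compatible connection is a connection $\nabla^{\mathcal E}:\Gamma(\mathcal E)\to\Gamma(\mathcal H^*\otimes\mathcal E)$ with $\nabla^{\mathcal E}_X(c(v)s)=c(\nabla^{\mathcal H}_Xv)s+c(v)\nabla^{\mathcal E}_Xs$ for local sections $X,v$ of $\mathcal H$ and $s$ of $\mathcal E$, where $\nabla^{\mathcal H}$ is a metric connection on $(\mathcal H,\bar g)$. Two local orthonormal frames on a common domain are related by a smooth map to the orthogonal group $O(r)$. *)

(* Defs.v *)
From HB Require Import structures.
From mathcomp Require Import all_boot all_order all_algebra finmap.
From mathcomp Require Import all_classical all_reals all_analysis.
Import Order.TTheory GRing.Theory Num.Theory numFieldNormedType.Exports.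

Set Implicit Arguments.
Unset Strict Implicit.
Unset Printing Implicit Defensive.

Local Open Scope classical_set_scope.
Local Open Scope ring_scope.

(** * Submodules, spans and quotients *)

Record submodule (R : pzRingType) (V : lmodType R) := Submodule {
  subm_set : set V ;
  subm_closed : submod_closed [pred v | v \in subm_set] }.

Definition subm (R : pzRingType) (V : lmodType R) (S : submodule V) : Type :=
  {v : V | v \in subm_set S}.

Section SubmoduleType.
Variables (R : pzRingType) (V : lmodType R) (S : submodule V).

HB.instance Definition _ := Choice.on (subm S).
HB.instance Definition _ := SubChoice.on (subm S).
HB.instance Definition _ :=
  GRing.SubChoice_isSubLmodule.Build R V _ (subm S) (subm_closed S).

End SubmoduleType.

Section Span.
Variables (R : pzRingType) (V : lmodType R).

Definition span_set (A : set V) : set V :=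
  [set v | forall S : submodule V, A `<=` subm_set S -> subm_set S v].

Lemma span_closed A : submod_closed [pred v | v \in span_set A].
Proof.
split=> [|a u v]; rewrite !inE.
  by move=> S _; have [] := subm_closed S; rewrite !inE.
move=> Au Av S AS; have [_ /(_ a u v)] := subm_closed S; rewrite !inE.
by apply; [exact: Au|exact: Av].
Qed.

Definition mspan A : submodule V := Submodule (span_closed A).

End Span.

(* The quotient of a type by an equivalence relation, as the type of classes. *)
Section Quotient.
Variables (T : Type) (e : T -> T -> Prop).

Definition quot : Type := {A : set T | exists t, A = e t}.

Definition cls (t : T) : quot := exist _ (e t : set T) (ex_intro _ t erefl).

Definition qrepr (a : quot) : T := sval (cid (svalP a)).

Lemma reprK a : cls (qrepr a) = a.
Proof.
by rewrite /qrepr; case: cid => t /=; case: a => A pA /= ?; exact/esym/eq_exist.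
Qed.

Hypothesis e_refl : forall t, e t t.
Hypothesis e_sym : forall t u, e t u -> e u t.
Hypothesis e_trans : forall t u v, e t u -> e u v -> e t v.

Lemma clsE t u : e t u -> cls t = cls u.
Proof.
move=> tu; apply: eq_exist => /=; apply/funext => v; apply/propext; split.
  by move/(e_trans (e_sym tu)).
exact: e_trans.
Qed.

Lemma cls_inj t u : cls t = cls u -> e t u.
Proof. by move=> /(congr1 (@sval _ _)) /= ->. Qed.

Lemma repr_cls t : e t (qrepr (cls t)).
Proof. by apply: cls_inj; rewrite reprK. Qed.

End Quotient.

HB.instance Definition _ T (e : T -> T -> Prop) := gen_eqMixin (quot e).
HB.instance Definition _ T (e : T -> T -> Prop) := gen_choiceMixin (quot e).

Section QuotientModule.
Variables (R : pzRingType) (V : lmodType R) (K : submodule V).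

Definition congruent (v w : V) : Prop := subm_set K (v - w).

Definition quotmod : Type := quot congruent.

Let K0 : subm_set K 0.
Proof. by have [] := subm_closed K; rewrite !inE. Qed.

Let Klin a v w : subm_set K v -> subm_set K w -> subm_set K (a *: v + w).
Proof. by have [_ /(_ a v w)] := subm_closed K; rewrite !inE. Qed.

Let congr_refl v : congruent v v.
Proof. by rewrite /congruent subrr. Qed.

Let congr_sym v w : congruent v w -> congruent w v.
Proof.
by move=> vw; have := Klin (-1) vw K0; rewrite scaleN1r addr0 opprB.
Qed.

Let congr_trans u v w : congruent u v -> congruent v w -> congruent u w.
Proof.
by move=> uv vw; have := Klin 1 uv vw; rewrite scale1r subrKA.
Qed.

Definition mproj : V -> quotmod := @cls V congruent.

Lemma mproj_eq v w : mproj v = mproj w <-> subm_set K (v - w).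
Proof. by split; [exact: cls_inj|exact: clsE]. Qed.

Lemma congr_repr v : subm_set K (v - qrepr (mproj v)).
Proof. by apply/mproj_eq; rewrite [RHS]reprK. Qed.

Definition quot_add (a b : quotmod) : quotmod := mproj (qrepr a + qrepr b).
Definition quot_scale (c : R) (a : quotmod) : quotmod := mproj (c *: qrepr a).

Let addE v w : quot_add (mproj v) (mproj w) = mproj (v + w).
Proof.
apply/esym/mproj_eq; have := Klin 1 (congr_repr v) (congr_repr w).
by rewrite scale1r addrACA -opprD.
Qed.

Let scaleE c v : quot_scale c (mproj v) = mproj (c *: v).
Proof.
apply/esym/mproj_eq; have := Klin c (congr_repr v) K0.
by rewrite addr0 scalerBr.
Qed.

Let quotP (P : quotmod -> Prop) : (forall v, P (mproj v)) -> forall a, P a.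
Proof. by move=> H a; rewrite -[a]reprK; exact: H. Qed.

Let addA : associative quot_add.
Proof.
by elim/quotP=> u; elim/quotP=> v; elim/quotP=> w; rewrite !addE addrA.
Qed.

Let addC : commutative quot_add.
Proof. by elim/quotP=> u; elim/quotP=> v; rewrite !addE addrC. Qed.

Let add0 : left_id (mproj 0) quot_add.
Proof. by elim/quotP=> u; rewrite addE add0r. Qed.

Let addN : left_inverse (mproj 0) (quot_scale (-1)) quot_add.
Proof. by elim/quotP=> u; rewrite scaleE addE scaleN1r addNr. Qed.

HB.instance Definition _ := Choice.on quotmod.
HB.instance Definition _ := GRing.isZmodule.Build quotmod addA addC add0 addN.

Let quot_addE (a b : quotmod) : a + b = quot_add a b.
Proof. by []. Qed.

Let scaleA a b (v : quotmod) :
  quot_scale a (quot_scale b v) = quot_scale (a * b) v.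
Proof. by elim/quotP: v => v; rewrite !scaleE scalerA. Qed.

Let scale1 : left_id 1 quot_scale.
Proof. by elim/quotP=> v; rewrite scaleE scale1r. Qed.

Let scaleDr : right_distributive quot_scale +%R.
Proof.
move=> a; elim/quotP=> v; elim/quotP=> w.
by rewrite !quot_addE addE !scaleE addE scalerDr.
Qed.

Let scaleDl (v : quotmod) : {morph quot_scale^~ v : a b / a + b}.
Proof.
by elim/quotP: v => v a b; rewrite quot_addE !scaleE addE scalerDl.
Qed.

HB.instance Definition _ :=
  GRing.Zmodule_isLmodule.Build R quotmod scaleA scale1 scaleDr scaleDl.

Lemma mprojD v w : mproj (v + w) = mproj v + mproj w.
Proof. by rewrite [RHS]addE. Qed.

Lemma mprojZ c v : mproj (c *: v) = c *: mproj v.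
Proof. by rewrite [RHS]scaleE. Qed.

End QuotientModule.

(** * Clifford algebras *)

Section Clifford.
Variables (R : comPzRingType) (V : lmodType R) (q : V -> V -> R).

(* Formal expressions for the elements of the free unital associative algebra on [V]. *)
Inductive cl_term : Type :=
| ClGen of V
| ClZero
| ClOne
| ClAdd of cl_term & cl_term
| ClMul of cl_term & cl_term
| ClScale of R & cl_term.

Let one := ClOne.
Let add := ClAdd.
Let mul := ClMul.
Let scale := ClScale.

(* The congruence generated by the axioms of unital associative algebras, the
   linearity of the generators and the Clifford relation. *)
Inductive cl_rel : cl_term -> cl_term -> Prop :=
| cl_refl t : cl_rel t t
| cl_sym t u : cl_rel t u -> cl_rel u t
| cl_trans t u v : cl_rel t u -> cl_rel u v -> cl_rel t v
| cl_congrD t t' u u' : cl_rel t t' -> cl_rel u u' ->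
    cl_rel (add t u) (add t' u')
| cl_congrM t t' u u' : cl_rel t t' -> cl_rel u u' ->
    cl_rel (mul t u) (mul t' u')
| cl_congrZ a t t' : cl_rel t t' -> cl_rel (scale a t) (scale a t')
| cl_addA t u v : cl_rel (add t (add u v)) (add (add t u) v)
| cl_addC t u : cl_rel (add t u) (add u t)
| cl_add0 t : cl_rel (add ClZero t) t
| cl_addN t : cl_rel (add (scale (-1) t) t) ClZero
| cl_mulA t u v : cl_rel (mul t (mul u v)) (mul (mul t u) v)
| cl_mul1t t : cl_rel (mul one t) t
| cl_mult1 t : cl_rel (mul t one) t
| cl_mulDl t u v : cl_rel (mul (add t u) v) (add (mul t v) (mul u v))
| cl_mulDr t u v : cl_rel (mul t (add u v)) (add (mul t u) (mul t v))
| cl_scaleA a b t : cl_rel (scale a (scale b t)) (scale (a * b) t)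
| cl_scale1 t : cl_rel (scale 1 t) t
| cl_scaleDr a t u : cl_rel (scale a (add t u)) (add (scale a t) (scale a u))
| cl_scaleDl a b t : cl_rel (scale (a + b) t) (add (scale a t) (scale b t))
| cl_scaleAl a t u : cl_rel (scale a (mul t u)) (mul (scale a t) u)
| cl_scaleAr a t u : cl_rel (scale a (mul t u)) (mul t (scale a u))
| cl_gen_linear a v w :
    cl_rel (ClGen (a *: v + w)) (add (scale a (ClGen v)) (ClGen w))
| cl_gen_clifford v w :
    cl_rel (add (mul (ClGen v) (ClGen w)) (mul (ClGen w) (ClGen v)))
           (scale (- 2%:R * q v w) one).

Definition clifford : Type := quot cl_rel.

Definition cl_cls : cl_term -> clifford := @cls cl_term cl_rel.

Let clsP t u : cl_rel t u -> cl_cls t = cl_cls u.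
Proof. by apply: clsE; [exact: cl_sym|exact: cl_trans]. Qed.

Let reprP t : cl_rel t (qrepr (cl_cls t)).
Proof. exact: (repr_cls cl_refl). Qed.

Definition cl_add (a b : clifford) : clifford :=
  cl_cls (add (qrepr a) (qrepr b)).
Definition cl_mul (a b : clifford) : clifford :=
  cl_cls (mul (qrepr a) (qrepr b)).
Definition cl_scale c (a : clifford) : clifford := cl_cls (scale c (qrepr a)).

Let addE t u : cl_add (cl_cls t) (cl_cls u) = cl_cls (add t u).
Proof. by apply/esym/clsP/cl_congrD; exact: reprP. Qed.

Let mulE t u : cl_mul (cl_cls t) (cl_cls u) = cl_cls (mul t u).
Proof. by apply/esym/clsP/cl_congrM; exact: reprP. Qed.

Let scaleE a t : cl_scale a (cl_cls t) = cl_cls (scale a t).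
Proof. by apply/esym/clsP/cl_congrZ; exact: reprP. Qed.

Let cliffordP (P : clifford -> Prop) :
  (forall t, P (cl_cls t)) -> forall a, P a.
Proof. by move=> H a; rewrite -[a]reprK; exact: H. Qed.

Let addA : associative cl_add.
Proof.
elim/cliffordP=> t; elim/cliffordP=> u; elim/cliffordP=> v.
by rewrite !addE; exact/clsP/cl_addA.
Qed.

Let addC : commutative cl_add.
Proof.
by elim/cliffordP=> t; elim/cliffordP=> u; rewrite !addE; exact/clsP/cl_addC.
Qed.

Let add0 : left_id (cl_cls ClZero) cl_add.
Proof. by elim/cliffordP=> t; rewrite addE; exact/clsP/cl_add0. Qed.

Let addN : left_inverse (cl_cls ClZero) (cl_scale (-1)) cl_add.
Proof. by elim/cliffordP=> t; rewrite scaleE addE; exact/clsP/cl_addN. Qed.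

HB.instance Definition _ := Choice.on clifford.
HB.instance Definition _ := GRing.isZmodule.Build clifford addA addC add0 addN.

Let cl_addE (a b : clifford) : a + b = cl_add a b.
Proof. by []. Qed.

Let mulA : associative cl_mul.
Proof.
elim/cliffordP=> t; elim/cliffordP=> u; elim/cliffordP=> v.
by rewrite !mulE; exact/clsP/cl_mulA.
Qed.

Let mul1t : left_id (cl_cls one) cl_mul.
Proof. by elim/cliffordP=> t; rewrite mulE; exact/clsP/cl_mul1t. Qed.

Let mult1 : right_id (cl_cls one) cl_mul.
Proof. by elim/cliffordP=> t; rewrite mulE; exact/clsP/cl_mult1. Qed.

Let mulDl : left_distributive cl_mul +%R.
Proof.
elim/cliffordP=> t; elim/cliffordP=> u; elim/cliffordP=> v.
by rewrite !cl_addE addE !mulE addE; exact/clsP/cl_mulDl.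
Qed.

Let mulDr : right_distributive cl_mul +%R.
Proof.
elim/cliffordP=> t; elim/cliffordP=> u; elim/cliffordP=> v.
by rewrite !cl_addE addE !mulE addE; exact/clsP/cl_mulDr.
Qed.

HB.instance Definition _ :=
  GRing.Zmodule_isPzRing.Build clifford mulA mul1t mult1 mulDl mulDr.

Let cl_mulE (a b : clifford) : a * b = cl_mul a b.
Proof. by []. Qed.

Let scaleA a b (t : clifford) : cl_scale a (cl_scale b t) = cl_scale (a * b) t.
Proof. by elim/cliffordP: t => t; rewrite !scaleE; exact/clsP/cl_scaleA. Qed.

Let scale1 : left_id 1 cl_scale.
Proof. by elim/cliffordP=> t; rewrite scaleE; exact/clsP/cl_scale1. Qed.

Let scaleDr : right_distributive cl_scale +%R.
Proof.
move=> a; elim/cliffordP=> t; elim/cliffordP=> u.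
by rewrite !cl_addE addE !scaleE addE; exact/clsP/cl_scaleDr.
Qed.

Let scaleDl (t : clifford) : {morph cl_scale^~ t : a b / a + b}.
Proof.
elim/cliffordP: t => t a b; rewrite cl_addE !scaleE addE.
exact/clsP/cl_scaleDl.
Qed.

HB.instance Definition _ :=
  GRing.Zmodule_isLmodule.Build R clifford scaleA scale1 scaleDr scaleDl.

Let cl_scaleE a (t : clifford) : a *: t = cl_scale a t.
Proof. by []. Qed.

Lemma cl_scalerAl a (t u : clifford) : a *: (t * u) = (a *: t) * u.
Proof.
elim/cliffordP: t => t; elim/cliffordP: u => u.
by rewrite !cl_mulE !cl_scaleE mulE !scaleE mulE; exact/clsP/cl_scaleAl.
Qed.

Lemma cl_scalerAr a (t u : clifford) : a *: (t * u) = t * (a *: u).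
Proof.
elim/cliffordP: t => t; elim/cliffordP: u => u.
by rewrite !cl_mulE !cl_scaleE mulE !scaleE mulE; exact/clsP/cl_scaleAr.
Qed.

Definition cl_gen (v : V) : clifford := cl_cls (ClGen v).

Lemma cl_gen_is_linear a v w : cl_gen (a *: v + w) = a *: cl_gen v + cl_gen w.
Proof.
rewrite cl_addE cl_scaleE scaleE addE.
exact/clsP/cl_gen_linear.
Qed.

Lemma cl_genM v w :
  cl_gen v * cl_gen w + cl_gen w * cl_gen v = (- 2%:R * q v w) *: (1 : clifford).
Proof.
rewrite cl_addE !cl_mulE cl_scaleE !mulE addE scaleE.
exact/clsP/cl_gen_clifford.
Qed.

End Clifford.

(** * Diffeological spaces *)

Section Diffeology.
Variable R : realType.

(* All iterated directional derivatives exist and are continuous on [U]; only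
   used for [U] open, so that the values of [f] off [U] do not matter. *)
Fixpoint iter_derive n (W : normedModType R) (vs : seq 'rV[R]_n)
    (f : 'rV[R]_n -> W) : 'rV[R]_n -> W :=
  if vs is v :: vs' then iter_derive vs' (fun x => 'D_v f x) else f.

Definition smooth_on n (W : normedModType R) (U : set 'rV[R]_n)
    (f : 'rV[R]_n -> W) : Prop :=
  forall (vs : seq 'rV[R]_n) x, U x ->
    {for x, continuous (iter_derive vs f)} /\
    forall v, derivable (iter_derive vs f) x v.

(* A plot is a map on an open subset [U] of some R^n; it is represented by a
   total function, whose values off [U] are irrelevant. *)
Record diffeology (T : Type) := Diffeology {
  plot : forall n, set 'rV[R]_n -> ('rV[R]_n -> T) -> Prop ;
  plot_open : forall n (U : set 'rV[R]_n) p, plot U p -> open U ;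
  plot_ext : forall n (U : set 'rV[R]_n) p q,
    (forall u, U u -> p u = q u) -> plot U p -> plot U q ;
  plot_cst : forall n (U : set 'rV[R]_n) t, open U -> plot U (fun=> t) ;
  plot_local : forall n (U : set 'rV[R]_n) p, open U ->
    (forall u, U u -> exists2 V, V u & plot V p) -> plot U p ;
  plot_comp : forall n m (U : set 'rV[R]_n) (V : set 'rV[R]_m) p
      (F : 'rV[R]_m -> 'rV[R]_n),
    plot U p -> open V -> smooth_on V F -> (forall v, V v -> U (F v)) ->
    plot V (p \o F) }.

Section Finest.
Variables (T : Type) (P : diffeology T -> Prop).

Let fplot n (U : set 'rV[R]_n) (p : 'rV[R]_n -> T) : Prop :=
  open U /\ forall D, P D -> plot D U p.

Let fplot_open n (U : set 'rV[R]_n) p : fplot U p -> open U.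
Proof. by case. Qed.

Let fplot_ext n (U : set 'rV[R]_n) p q :
  (forall u, U u -> p u = q u) -> fplot U p -> fplot U q.
Proof. by move=> pq [oU Up]; split=> // D /Up; exact: plot_ext. Qed.

Let fplot_cst n (U : set 'rV[R]_n) t : open U -> fplot U (fun=> t).
Proof. by move=> oU; split=> // D _; exact: plot_cst. Qed.

Let fplot_local n (U : set 'rV[R]_n) p : open U ->
  (forall u, U u -> exists2 V, V u & fplot V p) -> fplot U p.
Proof.
move=> oU loc; split=> // D PD; apply: plot_local => // u /loc[V Vu [_ Vp]].
by exists V => //; exact: Vp.
Qed.

Let fplot_comp n m (U : set 'rV[R]_n) (V : set 'rV[R]_m) p
    (F : 'rV[R]_m -> 'rV[R]_n) :
  fplot U p -> open V -> smooth_on V F -> (forall v, V v -> U (F v)) ->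
  fplot V (p \o F).
Proof.
by move=> [_ Up] oV sF VU; split=> // D /Up DUp; exact: plot_comp sF VU.
Qed.

(* The intersection of the diffeologies satisfying [P]: the finest diffeology
   satisfying [P] whenever [P] is stable under intersections. *)
Definition finest : diffeology T :=
  Diffeology fplot_open fplot_ext fplot_cst fplot_local fplot_comp.

End Finest.

Section DTopology.
Variables (X : Type) (dX : diffeology X).

Definition Dopen (A : set X) : Prop :=
  forall n (U : set 'rV[R]_n) p, plot dX U p -> open (U `&` p @^-1` A).

Definition smooth_fun (A : set X) (f : X -> R) : Prop :=
  forall n (U : set 'rV[R]_n) p, plot dX U p -> U `<=` p @^-1` A ->
    smooth_on U (f \o p).

Definition smooth_near (x : X) (f : X -> R) : Prop :=
  exists A, [/\ Dopen A, A x & smooth_fun A f].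

(* Velocity at [u], in the direction [xi], of a plot [p]: the derivation
   f |-> d(f o p)_u(xi) on the functions that are smooth near [p u], extended
   by 0 to the other functions in order to have an ambient vector space that
   does not depend on the base point. *)
Definition velocity n (p : 'rV[R]_n -> X) (u xi : 'rV[R]_n) : (X -> R) -> R :=
  fun f => if `[< smooth_near (p u) f >] then 'D_xi (f \o p) u else 0.

Definition velocities (x : X) : set ((X -> R) -> R) :=
  [set v | exists n (U : set 'rV[R]_n) p u xi,
     [/\ plot dX U p, U u, p u = x & v = velocity p u xi]].

(* The internal tangent space: the span of the velocities of the plots. *)
Definition tangent (x : X) : lmodType R := subm (mspan (velocities x)).

End DTopology.

(** * Vector pseudo-bundles *)

Record bundle (X : Type) := Bundle {
  fiber :> X -> lmodType R ;
  btotal : diffeology {x : X & fiber x} }.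

Definition bplot X (E : X -> lmodType R) (D : diffeology {x : X & E x})
    n (U : set 'rV[R]_n) (x : 'rV[R]_n -> X) (s : forall u, E (x u)) : Prop :=
  plot D U (fun u => existT (fun y => E y : Type) (x u) (s u)).

Record pseudo_bundle_diffeology X (dX : diffeology X) (E : X -> lmodType R)
    (D : diffeology {x : X & E x}) : Prop := {
  pb_proj : forall n (U : set 'rV[R]_n) x s, @bplot X E D n U x s ->
    plot dX U x ;
  pb_zero : forall n (U : set 'rV[R]_n) x, plot dX U x ->
    bplot D U (fun u => 0 : E (x u)) ;
  pb_add : forall n (U : set 'rV[R]_n) x (s t : forall u, E (x u)),
    bplot D U s -> bplot D U t -> bplot D U (fun u => s u + t u) ;
  pb_scale : forall n (U : set 'rV[R]_n) x (a : 'rV[R]_n -> R)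
      (s : forall u, E (x u)),
    smooth_on U (a : 'rV[R]_n -> R^o) -> bplot D U s ->
    bplot D U (fun u => a u *: s u) }.

Definition pseudo_bundle X (dX : diffeology X) (E : bundle X) : Prop :=
  pseudo_bundle_diffeology dX (btotal E).

Definition smooth_section X (dX : diffeology X) (E : bundle X) (A : set X)
    (s : forall x, E x) : Prop :=
  forall n (U : set 'rV[R]_n) p, plot dX U p -> U `<=` p @^-1` A ->
    bplot (btotal E) U (fun u => s (p u)).

(* The finest pseudo-bundle diffeology for which the tangent maps
   (u, xi) |-> dp_u(xi) of the plots [p] of [X] are smooth. *)
Definition tangent_bundle X (dX : diffeology X) : bundle X :=
  @Bundle X (tangent dX) (finest (fun D =>
    pseudo_bundle_diffeology dX D /\
    forall n (U : set 'rV[R]_n) p, plot dX U p ->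
    forall k (V : set 'rV[R]_k) (al xi : 'rV[R]_k -> 'rV[R]_n)
      (v : forall w, tangent dX (p (al w))),
      open V -> smooth_on V al -> smooth_on V xi ->
      (forall w, V w -> U (al w)) ->
      (forall w, V w -> val (v w) = velocity dX p (al w) (xi w)) ->
      bplot D V v)).

Record metric X (E : X -> lmodType R) := Metric {
  mform :> forall x, E x -> E x -> R ;
  mform_sym : forall x (v w : E x), mform v w = mform w v ;
  mform_lin : forall x a (u v w : E x),
    mform (a *: u + v) w = a * mform u w + mform v w }.

Definition nondegenerate_metric X (E : X -> lmodType R) (g : metric E) : Prop :=
  forall x (v : E x), (forall w, g x v w = 0) -> v = 0.

(** * Lie groups, as diffeological groups that are manifolds *)

Definition chart X (dX : diffeology X) n (U : set 'rV[R]_n)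
    (phi : 'rV[R]_n -> X) : Prop :=
  [/\ plot dX U phi, {in U &, injective phi}, Dopen dX (phi @` U) &
      forall k (V : set 'rV[R]_k) q, plot dX V q ->
        (forall v, V v -> (phi @` U) (q v)) ->
        exists2 F : 'rV[R]_k -> 'rV[R]_n, smooth_on V F &
          forall v, V v -> U (F v) /\ phi (F v) = q v].

Record lie_group (G : groupType) (dG : diffeology G) : Prop := {
  lie_mul : forall n (U : set 'rV[R]_n) p q, plot dG U p -> plot dG U q ->
    plot dG U (fun u => p u * q u)%g ;
  lie_inv : forall n (U : set 'rV[R]_n) p, plot dG U p ->
    plot dG U (fun u => (p u)^-1)%g ;
  lie_chart : exists n, forall h : G, exists (U : set 'rV[R]_n) phi,
    chart dG U phi /\ (phi @` U) h ;
  lie_hausdorff : forall h k : G, h <> k -> exists A B : set G,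
    [/\ Dopen dG A, Dopen dG B, A h, B k & A `&` B = set0] ;
  lie_second_countable : exists2 B : nat -> set G,
    forall i, Dopen dG (B i) &
    forall A h, Dopen dG A -> A h -> exists2 i, B i h & B i `<=` A }.

Section InvariantMetrics.
Variables (G : groupType) (dG : diffeology G) (m : metric (tangent dG)).

Definition riemannian : Prop :=
  (forall h (v : tangent dG h), v != 0 -> 0 < m h v v) /\
  (forall n (U : set 'rV[R]_n) p (xi eta : 'rV[R]_n)
      (v w : forall u, tangent dG (p u)), plot dG U p ->
    (forall u, U u -> val (v u) = velocity dG p u xi) ->
    (forall u, U u -> val (w u) = velocity dG p u eta) ->
    smooth_on U ((fun u => m (p u) (v u) (w u)) : 'rV[R]_n -> R^o)).

(* [m] is preserved by the diffeomorphism [tau]; any two tangent vectors at a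
   point are velocities of one and the same plot, namely a chart. *)
Definition preserved_by (tau : G -> G) : Prop :=
  forall n (U : set 'rV[R]_n) p u (xi eta : 'rV[R]_n)
    (v w : tangent dG (p u)) (v' w' : tangent dG (tau (p u))),
    plot dG U p -> U u ->
    val v = velocity dG p u xi -> val w = velocity dG p u eta ->
    val v' = velocity dG (tau \o p) u xi ->
    val w' = velocity dG (tau \o p) u eta ->
    m _ v' w' = m _ v w.

Definition left_invariant : Prop := forall a, preserved_by (fun h => a * h)%g.

Definition right_invariant : Prop := forall a, preserved_by (fun h => h * a)%g.

End InvariantMetrics.

(** * The spherical Milnor space *)

Section Milnor.
Variables (J : countType) (G : groupType) (dG : diffeology G).

(* The spherical Milnor space is the case J = nat; a finite [J] gives its finite
   stages, over which the horizontal pseudo-bundle can have finite rank. *)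
Record sph_family := SphFamily {
  fam_x : {fsfun J -> R with 0} ;
  fam_g : J -> G ;
  fam_sphere : \sum_(i <- finsupp fam_x) fam_x i ^+ 2 = 1 }.

Definition family_eq (a b : sph_family) : Prop :=
  fam_x a = fam_x b /\ forall i, fam_x a i != 0 -> fam_g a i = fam_g b i.

Definition milnor : Type := quot family_eq.

(* The local model S_A x G^A. *)
Record local_model (A : {fset J}) := LocalModel {
  lm_x : A -> R ;
  lm_g : A -> G ;
  lm_sphere : \sum_(i : A) lm_x i ^+ 2 = 1 }.

(* The product diffeology, S_A carrying the subset diffeology of R^A. *)
Definition model_plot (A : {fset J}) n (U : set 'rV[R]_n)
    (q : 'rV[R]_n -> local_model A) : Prop :=
  open U /\ forall i : A,
    smooth_on U ((fun u => lm_x (q u) i) : 'rV[R]_n -> R^o) /\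
    plot dG U (fun u => lm_g (q u) i).

Section FamilyOfModel.
Variables (A : {fset J}) (y : local_model A).

Let x0 : {fsfun J -> R with 0} := [fsfun i : A => lm_x y i | 0].

Let x0_sphere : \sum_(i <- finsupp x0) x0 i ^+ 2 = 1.
Proof.
have x0E (a : A) : x0 (val a) = lm_x y a by rewrite fsfun_ffun valK.
have := lm_sphere y; rewrite (eq_bigr (fun a => x0 (val a) ^+ 2)); last first.
  by move=> a _; rewrite x0E.
move=> <-; rewrite -(big_seq_fsetE _ A xpredT (fun i => x0 i ^+ 2)) /=.
apply: big_fset_incl => [|i _ /fsfun_dflt ->]; last by rewrite expr0n.
apply/fsubsetP => i; apply: contraLR => iA; rewrite memNfinsupp fsfun_ffun.
by rewrite insubN.
Qed.

(* The components of index i \notin A, where x_i = 0, are irrelevant. *)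
Definition family_of_model : sph_family :=
  SphFamily (fun i => if insub i is Some a then lm_g y a else 1%g) x0_sphere.

End FamilyOfModel.

Definition model_map (A : {fset J}) (y : local_model A) : milnor :=
  cls family_eq (family_of_model y).

Definition milnor_diffeology : diffeology milnor :=
  finest (fun D => forall (A : {fset J}) n (U : set 'rV[R]_n)
    (q : 'rV[R]_n -> local_model A),
    model_plot U q -> plot D U (fun u => model_map (q u))).

Definition milnor_tangent : bundle milnor := tangent_bundle milnor_diffeology.

(* [g] is the barycentric metric of the invariant metrics [m i] on the copies
   of G: for v and w the images of tangent vectors to a local model, with the
   coordinates (dx_i, dg_i) = (x_i'(xi), g_i'(xi)),
     g(v, w) = \sum_i dx_i(v) dx_i(w) + \sum_i x_i^2 <dg_i(v), dg_i(w)>_G.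
   The points q1 u1 and q2 u2 of the local model may differ (in a component
   g_i with x_i = 0) though they have the same image: the components i with
   x_i = 0 do not contribute to the last sum. *)
Definition barycentric (m : J -> metric (tangent dG))
    (g : metric milnor_tangent) : Prop :=
  forall (A : {fset J})
    n1 (U1 : set 'rV[R]_n1) (q1 : 'rV[R]_n1 -> local_model A) (u1 xi1 : 'rV_n1)
    n2 (U2 : set 'rV[R]_n2) (q2 : 'rV[R]_n2 -> local_model A) (u2 xi2 : 'rV_n2)
    (z : milnor) (v w : milnor_tangent z)
    (a b : forall i : A, tangent dG (lm_g (q1 u1) i)),
  model_plot U1 q1 -> U1 u1 -> model_map (q1 u1) = z ->
  model_plot U2 q2 -> U2 u2 -> model_map (q2 u2) = z ->
  val v = velocity milnor_diffeology (fun u => model_map (q1 u)) u1 xi1 ->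
  val w = velocity milnor_diffeology (fun u => model_map (q2 u)) u2 xi2 ->
  (forall i : A, lm_x (q1 u1) i != 0 ->
     val (a i) = velocity dG (fun u => lm_g (q1 u) i) u1 xi1) ->
  (forall i : A, lm_x (q1 u1) i != 0 ->
     val (b i) = velocity dG (fun u => lm_g (q2 u) i) u2 xi2) ->
  g z v w =
    \sum_(i : A) 'D_xi1 ((fun u => lm_x (q1 u) i) : 'rV_n1 -> R^o) u1 *
                 'D_xi2 ((fun u => lm_x (q2 u) i) : 'rV_n2 -> R^o) u2
    + \sum_(i : A) lm_x (q1 u1) i ^+ 2 * m (val i) _ (a i) (b i).

End Milnor.

(** * The horizontal pseudo-bundle H = TX / ker g *)

Section Horizontal.
Variables (X : Type) (dX : diffeology X) (g : metric (tangent_bundle dX)).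

Let T := tangent_bundle dX.

Definition ker_set x : set (T x) := [set v | forall w, g x v w = 0].

Lemma ker_closed x : submod_closed [pred v | v \in ker_set (x := x)].
Proof.
have g0 w : g x 0 w = 0.
  by have := mform_lin g (-1) 0 0 w; rewrite scaler0 addr0 mulN1r addNr.
split=> [|a u v]; rewrite !inE; first exact: g0.
by move=> ku kv w; rewrite mform_lin ku kv mulr0 addr0.
Qed.

Definition gker x : submodule (T x) := Submodule (@ker_closed x).

Definition hproj x : T x -> quotmod (gker x) := @mproj _ _ (gker x).

(* The quotient diffeology. *)
Definition horizontal : bundle X :=
  @Bundle X (fun x => quotmod (gker x)) (finest (fun D =>
    forall n (U : set 'rV[R]_n) x (v : forall u, T (x u)),
      bplot (btotal T) U v ->
      @bplot X (fun x => quotmod (gker x)) D n U x (fun u => hproj (v u)))).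

Definition hform x (a b : horizontal x) : R := g x (qrepr a) (qrepr b).

Let g_kerl x (u v w : T x) : subm_set (gker x) (u - v) -> g x u w = g x v w.
Proof.
move=> /(_ w); rewrite addrC -scaleN1r mform_lin mulN1r addrC => /eqP.
by rewrite subr_eq0 => /eqP.
Qed.

Let hform_sym x (a b : horizontal x) : hform a b = hform b a.
Proof. exact: mform_sym. Qed.

Lemma hformE x (v w : T x) : hform (hproj v : horizontal x) (hproj w) = g x v w.
Proof.
rewrite /hform -(g_kerl _ (congr_repr (gker x) v)) mform_sym.
rewrite -(g_kerl _ (congr_repr (gker x) w)).
exact: mform_sym.
Qed.

Let hform_lin x a (u v w : horizontal x) :
  hform (a *: u + v) w = a * hform u w + hform v w.
Proof.
rewrite -[u]reprK -[v]reprK -[w]reprK.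
have -> : a *: (cls _ (qrepr u) : horizontal x) + (cls _ (qrepr v) : horizontal x)
    = hproj (a *: qrepr u + qrepr v) by rewrite /hproj mprojD mprojZ.
by rewrite !hformE mform_lin.
Qed.

(* The metric induced by [g] on H. *)
Definition hmetric : metric horizontal := Metric hform_sym hform_lin.

Lemma hmetric_nondegenerate : nondegenerate_metric hmetric.
Proof.
move=> x v v0; rewrite -[v]reprK; apply/(mproj_eq (gker x)).
rewrite subr0 /= => w; rewrite -hformE; have := v0 (hproj w); congr (_ = _).
by congr hform; rewrite /hproj /mproj reprK.
Qed.

Definition is_basis (V : lmodType R) r (e : 'I_r -> V) : Prop :=
  forall v, exists! a : 'rV[R]_r, v = \sum_(i < r) a 0 i *: e i.

Definition locally_of_rank (H : bundle X) r : Prop :=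
  forall x, exists A, [/\ Dopen dX A, A x &
    forall y, A y -> exists e : 'I_r -> H y, is_basis e].

Definition orthonormal_frame (A : set X) r
    (e : 'I_r -> forall x, horizontal x) : Prop :=
  [/\ forall i, smooth_section dX A (e i),
      forall x, A x -> is_basis (fun i => e i x) &
      forall x, A x -> forall i j, hmetric x (e i x) (e j x) = (i == j)%:R].

(** * Connections *)

(* The functions on [A] whose differential vanishes on ker g, i.e. whose
   differential is a section of the dual of H = TX / ker g. *)
Definition basic_fun (A : set X) (f : X -> R) : Prop :=
  smooth_fun dX A f /\
  forall x, A x -> forall k : T x, ker_set k -> val k f = 0.

(* A connection acts on the sections over the D-open sets [A]; a local section
   is represented by a total section, whose values off [A] are irrelevant by
   [conn_local]. The Leibniz rule nabla (f s) = df (x) s + f nabla s makes sense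
   for the functions [f] such that df is a section of the dual of H. *)
Record connection (E : bundle X)
    (nabla : (forall x, E x) -> forall x, horizontal x -> E x) : Prop := {
  conn_local : forall A s s', Dopen dX A ->
    smooth_section dX A s -> smooth_section dX A s' ->
    (forall x, A x -> s x = s' x) ->
    forall x, A x -> forall h, nabla s x h = nabla s' x h ;
  conn_tensor : forall A s, Dopen dX A -> smooth_section dX A s ->
    forall x, A x -> forall a h k,
    nabla s x (a *: h + k) = a *: nabla s x h + nabla s x k ;
  conn_smooth : forall A s, Dopen dX A -> smooth_section dX A s ->
    forall n (U : set 'rV[R]_n) p (h : forall u, horizontal (p u)),
      bplot (btotal horizontal) U h -> U `<=` p @^-1` A ->
      bplot (btotal E) U (fun u => nabla s (p u) (h u)) ;
  conn_linear : forall A s s' a, Dopen dX A ->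
    smooth_section dX A s -> smooth_section dX A s' ->
    forall x, A x -> forall h,
    nabla (fun y => a *: s y + s' y) x h = a *: nabla s x h + nabla s' x h ;
  conn_leibniz : forall A f s, Dopen dX A -> basic_fun A f ->
    smooth_section dX A s ->
    forall x, A x -> forall v : T x,
    nabla (fun y => f y *: s y) x (hproj v) =
      val v f *: s x + f x *: nabla s x (hproj v) }.

(* The rule d(h(v, w)) = h(nabla v, w) + h(v, nabla w), when the left-hand side
   is a section of the dual of H. *)
Definition metric_connection
    (nabla : (forall x, horizontal x) -> forall x, horizontal x -> horizontal x)
    : Prop :=
  connection nabla /\
  forall A v w, Dopen dX A ->
    smooth_section dX A v -> smooth_section dX A w ->
    basic_fun A (fun y => hmetric y (v y) (w y)) ->
    forall x, A x -> forall Y : T x,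
    val Y (fun y => hmetric y (v y) (w y)) =
      hmetric x (nabla v x (hproj Y)) (w x) +
      hmetric x (v x) (nabla w x (hproj Y)).

(** * Clifford modules *)

Definition Cl x : lmodType R := clifford (hmetric x).

(* Cl(H), with the finest diffeology of pseudo-bundle of algebras for which the
   inclusion of H is smooth. *)
Definition clifford_bundle : bundle X :=
  @Bundle X Cl (finest (fun D =>
    [/\ pseudo_bundle_diffeology dX D,
        forall n (U : set 'rV[R]_n) x, plot dX U x ->
          @bplot X Cl D n U x (fun u => (1 : clifford (hmetric (x u)))),
        forall n (U : set 'rV[R]_n) x (a b : forall u, clifford (hmetric (x u))),
          @bplot X Cl D n U x a -> @bplot X Cl D n U x b ->
          @bplot X Cl D n U x (fun u => a u * b u) &
        forall n (U : set 'rV[R]_n) x (v : forall u, horizontal (x u)),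
          bplot (btotal horizontal) U v ->
          @bplot X Cl D n U x (fun u => cl_gen (hmetric (x u)) (v u))])).

Record clifford_module (E : bundle X)
    (act : forall x, clifford (hmetric x) -> E x -> E x) : Prop := {
  cm_bundle : pseudo_bundle dX E ;
  cm_linl : forall x k a b s, act x (k *: a + b) s = k *: act x a s + act x b s ;
  cm_linr : forall x a k s t, act x a (k *: s + t) = k *: act x a s + act x a t ;
  cm_one : forall x s, act x 1 s = s ;
  cm_mul : forall x a b s, act x (a * b) s = act x a (act x b s) ;
  cm_smooth : forall n (U : set 'rV[R]_n) p
      (a : forall u, clifford (hmetric (p u))) (s : forall u, E (p u)),
    bplot (btotal clifford_bundle) U a -> bplot (btotal E) U s ->
    bplot (btotal E) U (fun u => act (p u) (a u) (s u)) }.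

Section Dirac.
Variables (E : bundle X) (act : forall x, clifford (hmetric x) -> E x -> E x).

(* Clifford multiplication by a vector. *)
Definition cmul x (v : horizontal x) : E x -> E x := act (cl_gen (hmetric x) v).

Definition clifford_compatible
    (nablaH : (forall x, horizontal x) -> forall x, horizontal x -> horizontal x)
    (nablaE : (forall x, E x) -> forall x, horizontal x -> E x) : Prop :=
  forall A (Y v : forall x, horizontal x) (s : forall x, E x), Dopen dX A ->
    smooth_section dX A Y -> smooth_section dX A v -> smooth_section dX A s ->
    forall x, A x ->
    nablaE (fun y => cmul (v y) (s y)) x (Y x) =
      cmul (nablaH v x (Y x)) (s x) + cmul (v x) (nablaE s x (Y x)).

Definition dirac_op (nablaE : (forall x, E x) -> forall x, horizontal x -> E x) r
    (e : 'I_r -> forall x, horizontal x) (s : forall x, E x) (x : X) : E x :=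
  \sum_(i < r) cmul (e i x) (nablaE s x (e i x)).

End Dirac.

End Horizontal.

End Diffeology.

(* Main.v *)
Require Import Defs.
From HB Require Import structures.
From mathcomp Require Import all_boot all_order all_algebra finmap.
From mathcomp Require Import all_classical all_reals all_analysis.
Import Order.TTheory GRing.Theory Num.Theory numFieldNormedType.Exports.

(** At a point x, the operator D is the contraction of one bilinear map along the
    frame: B v w = c(v) (nabla_w s)(x) is linear in v, as Clifford multiplication
    is, and linear in w, as a connection is tensorial in its direction; and
    (D s)(x) = \sum_a B (e_a x) (e_a x).

    Write the second frame as e'_i = \sum_j O_ij e_j. Since both frames are
    orthonormal, the Gram matrix of e' gives O O^T = 1 ([orthonormal_change]).
    Expanding B on e' then gives \sum_(j, k) (O^T O)_jk B e_j e_k, and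
    O^T O = 1 because a one-sided inverse of a square matrix is two-sided
    ([contraction_change]). A connection differentiates s and not the
    direction, so only the value of the change of frame at x matters and no
    derivative of O appears. *)

Set Implicit Arguments.
Unset Strict Implicit.
Unset Printing Implicit Defensive.

Local Open Scope classical_set_scope.
Local Open Scope ring_scope.

Lemma linear_combination (R : pzRingType) (V W : lmodType R) r (f : V -> W)
    (a : 'I_r -> R) (e : 'I_r -> V) :
  linear f -> f (\sum_i a i *: e i) = \sum_i a i *: f (e i).
Proof.
move=> f_lin.
pose F : {linear V -> W} := HB.pack f (GRing.isLinear.Build R V W *:%R f f_lin).
by rewrite -[f]/(F : V -> W) linear_sum; apply: eq_bigr => i _; rewrite linearZ.
Qed.

Lemma scalar_combination (R : pzRingType) (V : lmodType R) r (f : V -> R)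
    (a : 'I_r -> R) (e : 'I_r -> V) :
  scalar f -> f (\sum_i a i *: e i) = \sum_i a i * f (e i).
Proof. exact: (@linear_combination R V R^o). Qed.

Section ChangeOfFrame.
Variables (R : comNzRingType) (V : lmodType R) (r : nat).
Variables (e e' : 'I_r -> V) (O : 'M[R]_r).
Hypothesis e'E : forall i, e' i = \sum_j O i j *: e j.

(** As the Gram matrix of [e] is the identity, that of [e'] is O O^T. *)
Lemma orthonormal_change (q : V -> V -> R) :
  (forall w, scalar (q^~ w)) -> (forall v, scalar (q v)) ->
  (forall i j, q (e i) (e j) = (i == j)%:R) ->
  (forall i j, q (e' i) (e' j) = (i == j)%:R) ->
  O *m O^T = 1%:M.
Proof.
move=> ql qr qe qe'; apply/matrixP => i k; rewrite !mxE -qe' !e'E.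
rewrite (scalar_combination _ _ (ql _)); apply: eq_bigr => j _.
rewrite (scalar_combination _ _ (qr _)) (bigD1 j) //= qe eqxx mulr1.
rewrite big1 ?addr0 ?mxE // => l lj.
by rewrite qe eq_sym (negPf lj) mulr0.
Qed.

(** Expanding the left-hand side on [e] gives B e_j e_k the coefficient
    (O^T O)_jk, whereas the hypothesis is on O O^T: commuting the two factors
    uses that O is square. *)
Lemma contraction_change (W : lmodType R) (B : V -> V -> W) :
  (forall w, linear (B^~ w)) -> (forall v, linear (B v)) ->
  O *m O^T = 1%:M ->
  \sum_i B (e' i) (e' i) = \sum_i B (e i) (e i).
Proof.
move=> Bl Br /mulmx1C OTO.
transitivity (\sum_i \sum_j \sum_k (O i j * O i k) *: B (e j) (e k)).
  apply: eq_bigr => i _; rewrite e'E (linear_combination _ _ (Bl _)).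
  apply: eq_bigr => j _; rewrite (linear_combination _ _ (Br _)) scaler_sumr.
  by apply: eq_bigr => k _; rewrite scalerA.
rewrite exchange_big; apply: eq_bigr => j _ /=; rewrite exchange_big /=.
have OTOE k : \sum_i O i j * O i k = (j == k)%:R.
  have /matrixP/(_ j k) := OTO; rewrite !mxE => <-.
  by apply: eq_bigr => i _; rewrite mxE.
under eq_bigr => k _ do rewrite -scaler_suml OTOE.
rewrite (bigD1 j) //= eqxx scale1r big1 ?addr0 // => k kj.
by rewrite eq_sym (negPf kj) scale0r.
Qed.

End ChangeOfFrame.

Lemma cmul_linear (R : realType) (X : Type) (dX : diffeology R X)
    (g : metric (tangent_bundle dX)) (E : bundle R X)
    (act : forall x, clifford (hmetric g x) -> E x -> E x) (x : X) (t : E x) :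
  clifford_module act -> linear (fun v : horizontal g x => cmul act v t).
Proof.
by move=> E_clifford a v w; rewrite /cmul cl_gen_is_linear (cm_linl E_clifford).
Qed.

(** The pointwise form of the argument: once x is fixed, the two frames are bases
    of the single fibre H_x, and D is the contraction of a bilinear map on it. *)
Lemma dirac_op_frame (R : realType) (X : Type) (dX : diffeology R X)
    (g : metric (tangent_bundle dX)) (E : bundle R X)
    (act : forall x, clifford (hmetric g x) -> E x -> E x)
    (nabla : (forall x, E x) -> forall x, horizontal g x -> E x)
    (A : set X) (r : nat) (e e' : 'I_r -> forall x, horizontal g x)
    (s : forall x, E x) :
  clifford_module act -> connection nabla -> Dopen dX A ->
  orthonormal_frame A e -> orthonormal_frame A e' -> smooth_section dX A s ->
  forall x, A x -> dirac_op act nabla e s x = dirac_op act nabla e' s x.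
Proof.
move=> E_cl nabla_conn A_open [_ e_basis e_on] [_ _ e'_on] s_smooth x Ax.
have e'_coord i : exists a : 'rV[R]_r, e' i x = \sum_j a 0 j *: e j x.
  by have [a [aE _]] := e_basis x Ax (e' i x); exists a.
have [a aE] := choice e'_coord.
pose O := \matrix_(i, j) a i 0 j.
have e'E i : e' i x = \sum_j O i j *: e j x.
  by rewrite aE; apply: eq_bigr => j _; rewrite mxE.
have q_linl w : scalar (fun v => hmetric g x v w).
  by move=> k u v; rewrite mform_lin.
have q_linr v : scalar (hmetric g x v).
  by move=> k u w; rewrite mform_sym mform_lin !(mform_sym _ v).
have O_orth := orthonormal_change e'E q_linl q_linr (e_on x Ax) (e'_on x Ax).
pose B (v w : horizontal g x) : E x := cmul act v (nabla s x w).
have B_linl w : linear (B^~ w) by exact: cmul_linear.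
have B_linr v : linear (B v).
  move=> k u w; rewrite /B (conn_tensor nabla_conn A_open s_smooth Ax).
  exact: (cm_linr E_cl).
exact/esym/(contraction_change e'E B_linl B_linr O_orth).
Qed.

Theorem proposition8p9
  (R : realType) (J : countType) (G : groupType) (dG : diffeology R G)
  (lieG : lie_group dG)
  (m : J -> metric (tangent dG))
  (m_riemannian : forall i, riemannian (m i))
  (m_invariant : forall i, left_invariant (m i) \/ right_invariant (m i))
  (g : metric (milnor_tangent J dG))
  (g_barycentric : barycentric m g)
  (r : nat)
  (H_rank : locally_of_rank (milnor_diffeology J dG) (horizontal g) r)
  (H_nondegenerate : nondegenerate_metric (hmetric g))
  (E : bundle R (milnor R J G))
  (act : forall x, clifford (hmetric g x) -> E x -> E x)
  (E_clifford : clifford_module act)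
  (nablaH : (forall x, horizontal g x) ->
            forall x, horizontal g x -> horizontal g x)
  (nablaH_metric : metric_connection nablaH)
  (nablaE : (forall x, E x) -> forall x, horizontal g x -> E x)
  (nablaE_connection : connection nablaE)
  (nablaE_clifford : clifford_compatible act nablaH nablaE)
  (A : set (milnor R J G))
  (A_open : Dopen (milnor_diffeology J dG) A)
  (e e' : 'I_r -> forall x, horizontal g x)
  (e_frame : orthonormal_frame A e)
  (e'_frame : orthonormal_frame A e')
  (s : forall x, E x)
  (s_section : smooth_section (milnor_diffeology J dG) A s) :
  forall x, A x -> dirac_op act nablaE e s x = dirac_op act nablaE e' s x.
Proof.
exact: dirac_op_frame A_open e_frame e'_frame s_section.
Qed.
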